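(* Let $F\subset\mathbb{R}^n$ be an intersection of two parallel (closed) halfspaces with opposite normals, such that $F$ has a nonempty interior; that is, $F=\{x\in\mathbb{R}^n : \alpha\le\langle d,x\rangle\le\beta\}$ with $\|d\|=1$ and $\alpha<\beta$. Then there exist $S\subset T\subset\mathbb{R}^n$, with $|S|=2$ and $|T|=4$, such that $V_T(S)=F$.
   Context: For a finite nonempty set $T\subset\mathbb{R}^n$ and a nonempty proper subset $S\subset T$, the multipoint (higher order) Voronoi cell is $$V_T(S):=\left\{x\in\mathbb{R}^n : \max_{s\in S}\|x-s\|\le\min_{t\in T\setminus S}\|x-t\|\right\},$$ where $\|\cdot\|$ is the Euclidean norm. *)

(* Defs.v *)
From HB Require Import structures.
From mathcomp Require Import all_boot all_order all_algebra finmap.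
From mathcomp Require Import all_classical all_reals.

Set Implicit Arguments.
Unset Strict Implicit.
Unset Printing Implicit Defensive.

Import Order.TTheory GRing.Theory Num.Theory.
Local Open Scope classical_set_scope.
Local Open Scope ring_scope.

Definition dotv (R : realType) (n : nat) (u v : 'rV[R]_n) : R :=
  \sum_(i < n) u ord0 i * v ord0 i.

(* The norm `|x| that MathComp-Analysis puts on 'rV[R]_n is the sup norm, so
   the Euclidean norm is defined separately. *)
Definition enorm (R : realType) (n : nat) (x : 'rV[R]_n) : R :=
  Num.sqrt (dotv x x).

(* The maximum and the minimum are computed in \bar R, whose bounds -oo and +oo
   are the neutral elements of max and min: over a nonempty finite set they
   are the usual real ones.  The cell is meant for S nonempty and strictly
   included in T. *)
Definition voronoi_cell (R : realType) (n : nat) (T S : {fset 'rV[R]_n}) :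
    set 'rV[R]_n :=
  [set x : 'rV[R]_n | (\big[Order.max/-oo]_(s <- S) (enorm (x - s))%:E <=
            \big[Order.min/+oo]_(t <- (T `\` S)%fset) (enorm (x - t))%:E)%E].

Definition slab (R : realType) (n : nat) (d : 'rV[R]_n) (a b : R) :
    set 'rV[R]_n :=
  [set x : 'rV[R]_n | a <= dotv d x <= b].

(* Main.v *)
Require Import Defs.
From HB Require Import structures.
From mathcomp Require Import all_boot all_order all_algebra finmap.
From mathcomp Require Import all_classical all_reals.
From mathcomp Require Import ring lra.

Set Implicit Arguments.
Unset Strict Implicit.
Unset Printing Implicit Defensive.

Import Order.TTheory GRing.Theory Num.Theory.
Local Open Scope classical_set_scope.
Local Open Scope ring_scope.

(** Put all four sites on the line spanned by [d]: the points [c *: d] with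
    [c = 2a - b, a, b, 2b - a], the middle two forming [S].  Whether [x] is
    closer to [c *: d] than to [c' *: d] only depends on the position of
    [dotv d x] relative to the midpoint of [c] and [c'].  The midpoint of [b] and
    [2a - b] is [a] and that of [a] and [2b - a] is [b]; the other two
    comparisons are implied by these. *)

Lemma dotvv_ge0 (R : realType) (n : nat) (x : 'rV[R]_n) : 0 <= dotv x x.
Proof. by apply: sumr_ge0 => i _; rewrite -expr2 sqr_ge0. Qed.

Lemma dotvv_subZ (R : realType) (n : nat) (x d : 'rV[R]_n) (c : R) :
  dotv (x - c *: d) (x - c *: d) =
  dotv x x - c * 2 * dotv d x + c ^+ 2 * dotv d d.
Proof.
rewrite /dotv !mulr_sumr -sumrB -big_split /=.
by apply: eq_bigr => i _; rewrite !mxE; ring.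
Qed.

(** A maximum is below a minimum exactly when all pairs compare, and monotonicity of the square root
    allows comparing squared norms. *)
Lemma voronoi_cellP (R : realType) (n : nat) (T S : {fset 'rV[R]_n})
    (x : 'rV[R]_n) :
  voronoi_cell T S x <->
  (forall s t, s \in S -> t \in (T `\` S)%fset ->
     dotv (x - s) (x - s) <= dotv (x - t) (x - t)).
Proof.
rewrite /voronoi_cell /=; split => [cell s t sS tT|cell].
  rewrite -ler_sqrt ?dotvv_ge0 // -lee_fin.
  apply: le_trans (le_trans cell _).
    exact: (le_bigmax_seq _ s xpredT (fun r => (enorm (x - r))%:E)).
  exact: (ge_bigmin_seq _ t xpredT (fun r => (enorm (x - r))%:E)).
rewrite big_seq; apply: bigmax_le => [|s sS]; first exact: leNye.
rewrite big_seq; apply: le_bigmin => [|t tT]; first exact: leey.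
by rewrite lee_fin ler_sqrt ?dotvv_ge0 ?cell.
Qed.

Theorem proposition3p7 (R : realType) (n : nat) (d : 'rV[R]_n) (a b : R)
    (d_unit : enorm d = 1) (a_lt_b : a < b) :
  exists S T : {fset 'rV[R]_n},
    [/\ (S `<=` T)%fset, #|` S|%fset = 2%N, #|` T|%fset = 4%N &
        voronoi_cell T S = slab d a b].
Proof.
have dd1 : dotv d d = 1 by rewrite -(sqr_sqrtr (dotvv_ge0 d)) -/(enorm d) d_unit expr1n.
(* Pairing with the unit vector [d] recovers the coefficient, so distinctness of sites reduces to
   that of reals. *)
have eqd c c' : (c *: d == c' *: d) = (c == c').
  apply/eqP/eqP => [|-> //] /(congr1 (dotv d)).
  have dZ k : dotv d (k *: d) = k.
    rewrite -[RHS]mulr1 -dd1 mulr_sumr.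
    by apply: eq_bigr => i _; rewrite mxE; ring.
  by rewrite !dZ.
pose S := [fset a *: d; b *: d]%fset.
pose U := [fset (2 * a - b) *: d; (2 * b - a) *: d]%fset.
have SU : [disjoint U & S]%fset.
  apply/fdisjointP => t; rewrite !inE => /orP[]/eqP->; rewrite !eqd negb_or.
    by apply/andP; split; apply/eqP; lra.
  by apply/andP; split; apply/eqP; lra.
have TS : ((S `|` U) `\` S = U)%fset.
  by rewrite fsetDUl fsetDv fset0U; apply/fsetDidPl.
have cardS : #|` S|%fset = 2%N by rewrite cardfs2 eqd lt_eqF.
have cardU : #|` U|%fset = 2%N.
  by rewrite cardfs2 eqd; case: eqP => // ?; exfalso; lra.
exists S, (S `|` U)%fset; split => //; first exact: fsubsetUl.
  by rewrite cardfsU cardS cardU fsetIC (eqP (SU : (_ == _))) cardfs0.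
apply/seteqP; split => x; rewrite /slab /=.
  move/voronoi_cellP; rewrite TS => cell.
  (* This pair yields [a <= dotv d x] and the next one [dotv d x <= b], after cancelling the
     positive factor [b - a]. *)
  have := cell (b *: d) ((2 * a - b) *: d); rewrite !inE !eqxx orbT.
  have := cell (a *: d) ((2 * b - a) *: d); rewrite !inE !eqxx orbT.
  by rewrite !dotvv_subZ dd1 => /(_ isT isT) h1 /(_ isT isT) h2; nra.
move=> /andP[ax xb]; apply/voronoi_cellP => s t; rewrite TS !inE.
(* With [y = dotv d x], the squared distances to [c *: d] and [c' *: d] differ by
   [(c - c') * (c + c' - 2 * y)]; its sign is checked for all four pairs. *)
by move=> /orP[]/eqP-> /orP[]/eqP->; rewrite !dotvv_subZ dd1; nra.
Qed.
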